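(* Let $(u_i^n)$, $(m_i^n)$, $i=1,\dots,N$ (indices $i$ taken periodically modulo $N$), $n=0,\dots,N_t$, be a solution of the following fully discrete mean field game scheme: for $i=1,\dots,N$ and $n=0,\dots,N_t-1$, $$\frac{u_i^{n+1}-u_i^n}{\tau}=\tfrac12\Big(-(\mathcal{L}(u^n+u^{n+1}))_i-H(x_i,(\mathcal{D}u^n)_i)-H(x_i,(\mathcal{D}u^{n+1})_i)+V[m^n]_i+V[m^{n+1}]_i\Big),$$ $$\frac{m_i^{n+1}-m_i^n}{\tau}=\tfrac12\Big((\mathcal{L}(m^n+m^{n+1}))_i-B_i(m^n,u^n)-B_i(m^{n+1},u^{n+1})\Big),$$ with $u_i^0=u_0(x_i)+V_0[m^0]_i$ and $m_i^{N_t}=m_T(x_i)$ for $i=1,\dots,N$. Then the total mass $h\sum_{i=1}^N m_i^n$ is conserved, i.e. it is independent of $n\in\{0,1,\dots,N_t\}$.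
   Context: The scheme discretizes, on $\Omega=[0,1]$ with periodic boundary conditions and on the time interval $[0,T]$, the mean field game system $$u_t-\nu\Delta u+H(x,\nabla u)=V[m],\quad u(0,x)=u_0(x)+V_0[m(0)](x);$$ $$-m_t-\nu\Delta m-\nabla\cdot(m\nabla_pH(x,\nabla u))=0,\quad m(T,x)=m_T(x).$$ Grid: $h=1/N$, $x_i=ih$, $\tau=T/N_t$, $N,N_t$ positive integers; all grid functions are $N$-periodic in $i$; $u^n=(u^n_i)_i$, $m^n=(m^n_i)_i$. $V$ and $V_0$ also denote given operators mapping grid functions to grid functions. For a grid function $W$, $$(\mathcal{D}W)_i^-=\frac{3W_i-4W_{i-1}+W_{i-2}}{2h},\qquad(\mathcal{D}W)_i^+=\frac{-3W_i+4W_{i+1}-W_{i+2}}{2h},\qquad(\mathcal{D}W)_i=((\mathcal{D}W)_i^-,(\mathcal{D}W)_i^+).$$ The discrete Laplacian term (discretizing $-\nu\Delta$) is $(\mathcal{L}W)_i=-\nu\,\dfrac{W_{i+1}-2W_i+W_{i-1}}{h^2}$. The discrete Hamiltonian $H(x_i,p_1,p_2)$, also denoted $H$, is a given real function, differentiable in $(p_1,p_2)\in\mathbb{R}^2$, evaluated at $(p_1,p_2)=(\mathcal{D}u)_i$. Write $\left(\frac{\partial H}{\partial p_j}\right)_i=\frac{\partial H}{\partial p_j}(x_i,(\mathcal{D}u)_i)$ for $j=1,2$. The discretization of $\nabla\cdot(m\nabla_pH(x,\nabla u))$ is $$B_i(m,u)=\frac1{2h}\Big[3m_i\big(\tfrac{\partial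 H}{\partial p_1}\big)_i-4m_{i-1}\big(\tfrac{\partial H}{\partial p_1}\big)_{i-1}+m_{i-2}\big(\tfrac{\partial H}{\partial p_1}\big)_{i-2}-3m_i\big(\tfrac{\partial H}{\partial p_2}\big)_i+4m_{i+1}\big(\tfrac{\partial H}{\partial p_2}\big)_{i+1}-m_{i+2}\big(\tfrac{\partial H}{\partial p_2}\big)_{i+2}\Big].$$ *)

(* Defs.v *)
From mathcomp Require Import all_boot all_order all_algebra.
From mathcomp Require Import all_classical all_reals all_analysis.

Set Implicit Arguments.
Unset Strict Implicit.
Unset Printing Implicit Defensive.

Import Order.TTheory GRing.Theory Num.Theory.
Import numFieldNormedType.Exports.

Local Open Scope ring_scope.

(* An N-periodic grid function (W_i) is given by its values over one period
   i = 1, ..., N.  The ordinal k : 'I_N (k = 0, ..., N - 1) encodes the class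
   modulo N of the index k + 1. *)
Definition grid_fun (R : realType) (N : nat) := 'I_N -> R.

(* [ordS] and [ord_pred] are the cyclic successor and predecessor on 'I_N, so
   that ip1, ip2, im1, im2 are i + 1, i + 2, i - 1, i - 2 modulo N; nothing is
   assumed on N here, and these indices may coincide for small N. *)
Definition ip1 (N : nat) (i : 'I_N) : 'I_N := ordS i.
Definition ip2 (N : nat) (i : 'I_N) : 'I_N := ordS (ordS i).
Definition im1 (N : nat) (i : 'I_N) : 'I_N := ord_pred i.
Definition im2 (N : nat) (i : 'I_N) : 'I_N := ord_pred (ord_pred i).

Section Scheme.
Variables (R : realType) (N : nat).
Implicit Types (W m u : grid_fun R N) (i : 'I_N).

Definition mesh : R := N%:R^-1.

(* The successor is due to the encoding of the indices 1, ..., N by 'I_N. *)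
Definition node i : R := (i.+1)%:R * mesh.

Definition Dminus W i : R :=
  (3 * W i - 4 * W (im1 i) + W (im2 i)) / (2 * mesh).

Definition Dplus W i : R :=
  (- 3 * W i + 4 * W (ip1 i) - W (ip2 i)) / (2 * mesh).

(* Discretization of - nu * Laplacian, sign included. *)
Definition Lap (nu : R) W i : R :=
  - nu * ((W (ip1 i) - 2 * W i + W (im1 i)) / mesh ^+ 2).

Variable H : R -> R -> R -> R.

Definition Ham u i : R := H (node i) (Dminus u i) (Dplus u i).

Definition dHam1 u i : R :=
  derive1 (fun p1 : R => H (node i) p1 (Dplus u i)) (Dminus u i).

Definition dHam2 u i : R :=
  derive1 (fun p2 : R => H (node i) (Dminus u i) p2) (Dplus u i).

Definition Bop m u i : R :=
  (2 * mesh)^-1 *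
  (3 * m i * dHam1 u i
   - 4 * m (im1 i) * dHam1 u (im1 i)
   + m (im2 i) * dHam1 u (im2 i)
   - 3 * m i * dHam2 u i
   + 4 * m (ip1 i) * dHam2 u (ip1 i)
   - m (ip2 i) * dHam2 u (ip2 i)).

End Scheme.

Arguments mesh : clear implicits.

Definition mass (R : realType) (N : nat) (m : grid_fun R N) : R :=
  mesh R N * \sum_(i < N) m i.

(* Main.v *)
(* Summing over one period is invariant under cyclic shifts, and the coefficients
   of each of the stencils of [Lap] and [Bop] add up to 0; hence both sum to 0
   over the grid, and summing the second equation leaves the total mass
   unchanged over one time step. *)
Require Import Defs.
From mathcomp Require Import all_boot all_order all_algebra.
From mathcomp Require Import all_classical all_reals all_analysis.
From mathcomp Require Import ring.
Import Order.TTheory GRing.Theory Num.Theory.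
Import numFieldNormedType.Exports.
Local Open Scope ring_scope.

Lemma sum_ordS {V : nmodType} {N : nat} (F : 'I_N -> V) :
  \sum_(i < N) F (ordS i) = \sum_(i < N) F i.
Proof. by rewrite [RHS](reindex _ (onW_bij _ (@ordS_bij N))). Qed.

Lemma sum_ord_pred {V : nmodType} {N : nat} (F : 'I_N -> V) :
  \sum_(i < N) F (ord_pred i) = \sum_(i < N) F i.
Proof. by rewrite [RHS](reindex _ (onW_bij _ (@ord_pred_bij N))). Qed.

Lemma sum_Lap (R : realType) (N : nat) (nu : R) (W : grid_fun R N) :
  \sum_(i < N) Lap nu W i = 0.
Proof.
rewrite /Lap /ip1 /im1 -mulr_sumr -mulr_suml !big_split /= sumrN -mulr_sumr.
rewrite sum_ordS sum_ord_pred; set S := \sum_(i < N) W i.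
by rewrite (_ : S - 2 * S + S = 0) ?mul0r ?mulr0 //; ring.
Qed.

(** The stencil acts on the two fluxes [F] and [G], with weights 3, -4, 1 and -3, 4, -1, so each
    flux cancels on its own, whatever [H] is. *)
Lemma sum_Bop (R : realType) (N : nat) (H : R -> R -> R -> R)
    (m u : grid_fun R N) :
  \sum_(i < N) Bop H m u i = 0.
Proof.
pose F i := m i * dHam1 H u i; pose G i := m i * dHam2 H u i.
rewrite /Bop -mulr_sumr.
under eq_bigr do rewrite -!mulrA -/(F _) -/(G _).
rewrite !big_split /= !sumrN -!mulr_sumr /im1 /im2 /ip1 /ip2.
(* A shift by two is a shift of the already shifted flux; it is undone one step at a time. *)
rewrite (sum_ordS (fun i => G (ordS i))) (sum_ordS G).
rewrite (sum_ord_pred (fun i => F (ord_pred i))) (sum_ord_pred F).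
by rewrite [X in _ * X](_ : _ = 0) ?mulr0 //; ring.
Qed.

Theorem proposition4
  (R : realType) (N Nt : nat) (hN : (0 < N)%N) (hNt : (0 < Nt)%N)
  (T nu : R) (hT : 0 < T)
  (H : R -> R -> R -> R)
  (hH : forall (i : 'I_N) (p : R * R),
    differentiable (fun q : R * R => H (node R i) q.1 q.2) p)
  (V V0 : grid_fun R N -> grid_fun R N)
  (u0 mT : R -> R)
  (tau : R) (htau : tau = T / Nt%:R)
  (u m : nat -> grid_fun R N)
  (hu : forall (n : nat) (i : 'I_N), (n < Nt)%N ->
    (u n.+1 i - u n i) / tau =
    2^-1 * (- Lap nu (fun j => u n j + u n.+1 j) i
            - Ham H (u n) i - Ham H (u n.+1) i
            + V (m n) i + V (m n.+1) i))
  (hm : forall (n : nat) (i : 'I_N), (n < Nt)%N ->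
    (m n.+1 i - m n i) / tau =
    2^-1 * (Lap nu (fun j => m n j + m n.+1 j) i
            - Bop H (m n) (u n) i - Bop H (m n.+1) (u n.+1) i))
  (hu0 : forall i : 'I_N, u 0%N i = u0 (node R i) + V0 (m 0%N) i)
  (hmT : forall i : 'I_N, m Nt i = mT (node R i)) :
  forall n k : nat, (n <= Nt)%N -> (k <= Nt)%N -> mass (m n) = mass (m k).
Proof.
(* Division by zero yields 0, so the scheme links consecutive time levels only when [tau] is
   nonzero. *)
have tau0 : tau != 0.
  by rewrite htau mulf_neq0 ?invr_eq0 ?pnatr_eq0 -?lt0n // gt_eqF.
have step n : (n < Nt)%N -> mass (m n.+1) = mass (m n).
  move=> ltn; congr (_ * _); apply/eqP; rewrite -subr_eq0 -sumrB.
  (* Multiplying by the inverse of [tau] produces the difference quotients of [hm]. *)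
  apply/eqP/(mulIf (invr_neq0 tau0)); rewrite mul0r mulr_suml.
  under eq_bigr do rewrite hm //.
  (* [sum_Lap] is applied directly to the grid function [m n + m n.+1]. *)
  by rewrite -mulr_sumr !big_split /= !sumrN sum_Lap !sum_Bop !subr0 mulr0.
have mass0 n : (n <= Nt)%N -> mass (m n) = mass (m 0%N).
  by elim: n => // n IHn ltn; rewrite step // IHn // ltnW.
by move=> n k len lek; rewrite !mass0.
Qed.
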